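(* Let $m\ge p\ge1$ and let $B_1,B_2\in\mathbb{R}^{m\times p}$ have singular value decompositions $B_1=U_1PV_1^T$ and $B_2=U_2\Sigma V_2^T$ with $P,\Sigma\in\mathbb{R}^{m\times p}$, where the upper-left diagonal blocks of $P$ and $\Sigma$ are $P_p=\operatorname{diag}(\rho_1,\dots,\rho_p)$ and $\Sigma_p=\operatorname{diag}(\sigma_1,\dots,\sigma_p)$, respectively. Then $$\operatorname{tr}(B_1^TB_2B_2^TB_1)-\operatorname{tr}(B_1^TB_2B_1^TB_2)\le\min\{\|B_1\|_F^2(\sigma_1^2+\sigma_2^2),\ \|B_2\|_F^2(\rho_1^2+\rho_2^2)\},$$ $$\operatorname{tr}(B_1B_2^TB_2B_1^T)-\operatorname{tr}(B_1^TB_2B_1^TB_2)\le\min\{\|B_1\|_F^2(\sigma_1^2+\sigma_2^2),\ \|B_2\|_F^2(\rho_1^2+\rho_2^2)\}.$$ As a consequence, $$\tfrac12\|B_1^TB_2-B_2^TB_1\|_F^2\le\|B_1\|_F^2\|B_2\|_F^2,\qquad \tfrac12\|B_1B_2^T-B_2B_1^T\|_F^2\le\|B_1\|_F^2\|B_2\|_F^2.$$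
   Context: $\|\cdot\|_F$ is the Frobenius norm. Singular values are ordered decreasingly: $\rho_1\ge\rho_2\ge\dots\ge\rho_p\ge0$ and $\sigma_1\ge\sigma_2\ge\dots\ge\sigma_p\ge0$; for $p=1$ set $\rho_2=\sigma_2=0$. *)

(* Defs.v *)
From HB Require Import structures.
From mathcomp Require Import all_boot all_order all_algebra.
From mathcomp Require Import reals.

Set Implicit Arguments.
Unset Strict Implicit.
Unset Printing Implicit Defensive.

Import Order.TTheory GRing.Theory Num.Theory.
Local Open Scope ring_scope.

Definition frob_norm (R : realType) (m n : nat) (A : 'M[R]_(m, n)) : R :=
  Num.sqrt (\sum_i \sum_j A i j ^+ 2).

Definition orthogonal_mx (R : realType) (n : nat) (U : 'M[R]_n) : Prop :=
  U^T *m U = 1%:M /\ U *m U^T = 1%:M.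

Definition rect_diag (R : realType) (m p : nat) (s : p.-tuple R) :
    'M[R]_(m, p) :=
  \matrix_(i, j) (if i == j :> nat then s`_j else 0).

(* Full singular value decomposition. The singular values are indexed from 0,
   so that s_1 and s_2 are s`_0 and s`_1; since s`_i is 0 beyond the length of
   the tuple, the convention s_2 = 0 for p = 1 is built in. *)
Definition is_svd (R : realType) (m p : nat) (B : 'M[R]_(m, p))
    (U : 'M[R]_m) (S : 'M[R]_(m, p)) (V : 'M[R]_p) (s : p.-tuple R) : Prop :=
  [/\ orthogonal_mx U,
      orthogonal_mx V,
      sorted (fun x y : R => y <= x) s /\ {in s, forall x, 0 <= x},
      S = rect_diag m s
    & B = U *m S *m V^T].

(* Main.v *)
(* For a square matrix X, tr (X X^T) - tr (X X) is half the squared norm of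
   X - X^T.  In the singular bases of B2, with A := U2^T B1 V2, both
   commutator-like matrices have entries x s_j - y s_i, where {x, y} is a pair
   of transposed entries of A padded with zeros to an m x m matrix.  The
   diagonal entries vanish, and for i <> j Cauchy-Schwarz gives
   (x s_j - y s_i)^2 <= (x^2 + y^2) (s_1^2 + s_2^2); now sum over i and j. *)
Require Import Defs.
From HB Require Import structures.
From mathcomp Require Import all_boot all_order all_algebra.
From mathcomp Require Import reals.
From mathcomp Require Import ring lra.

Set Implicit Arguments.
Unset Strict Implicit.
Unset Printing Implicit Defensive.

Import Order.TTheory GRing.Theory Num.Theory.
Local Open Scope ring_scope.

Lemma frob_norm_sqr (R : realType) (m n : nat) (A : 'M[R]_(m, n)) :
  frob_norm A ^+ 2 = \sum_i \sum_j A i j ^+ 2.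
Proof.
by rewrite sqr_sqrtr // !sumr_ge0 // => i _; rewrite sumr_ge0 // => j _;
  exact: sqr_ge0.
Qed.

Lemma frob_norm_tr (R : realType) (m n : nat) (A : 'M[R]_(m, n)) :
  frob_norm A = Num.sqrt (\tr (A *m A^T)).
Proof.
congr Num.sqrt; apply: eq_bigr => i _; rewrite mxE.
by apply: eq_bigr => j _; rewrite mxE expr2.
Qed.

Lemma frob_norm_sqr_tr (R : realType) (m n : nat) (A : 'M[R]_(m, n)) :
  frob_norm A ^+ 2 = \tr (A *m A^T).
Proof.
rewrite frob_norm_sqr; apply: eq_bigr => i _; rewrite mxE.
by apply: eq_bigr => j _; rewrite mxE expr2.
Qed.

Lemma frob_normT (R : realType) (m n : nat) (A : 'M[R]_(m, n)) :
  frob_norm A^T = frob_norm A.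
Proof. by rewrite !frob_norm_tr trmxK mxtrace_mulC. Qed.

Lemma frob_normN (R : realType) (m n : nat) (A : 'M[R]_(m, n)) :
  frob_norm (- A) = frob_norm A.
Proof. by rewrite !frob_norm_tr linearN /= mulmxN mulNmx opprK. Qed.

(** Rectangular [W] and [Q] with orthonormal columns are allowed, so that this covers zero padding
    as well as orthogonal changes of basis. *)
Lemma frob_norm_isometry (R : realType) (m n k l : nat) (W : 'M[R]_(k, m))
    (Q : 'M[R]_(l, n)) (A : 'M[R]_(m, n)) :
  W^T *m W = 1%:M -> Q^T *m Q = 1%:M ->
  frob_norm (W *m A *m Q^T) = frob_norm A.
Proof.
move=> WW QQ; rewrite !frob_norm_tr !trmx_mul trmxK !mulmxA mxtrace_mulC.
by rewrite -(mulmxA _ Q^T Q) QQ mulmx1 !mulmxA WW mul1mx.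
Qed.

(** The square expands into four traces, equal in pairs by cyclicity and invariance under
    transposition. *)
Lemma half_frob_norm_skew (R : realType) (n : nat) (X : 'M[R]_n) :
  2^-1 * frob_norm (X - X^T) ^+ 2 = \tr (X *m X^T) - \tr (X *m X).
Proof.
rewrite frob_norm_sqr_tr linearB /= trmxK mulmxBl !mulmxBr !linearB /=.
rewrite (mxtrace_mulC X^T X) -(mxtrace_tr (X^T *m X^T)) trmx_mul trmxK.
by field.
Qed.

(** Indices past the end are harmless: the default 0 prolongs a nonincreasing nonnegative sequence
    to another one. *)
Lemma nth_nonincreasing (R : numDomainType) (s : seq R) (i j : nat) :
  sorted (fun x y : R => y <= x) s -> {in s, forall x, 0 <= x} ->
  (i <= j)%N -> 0 <= s`_j <= s`_i.
Proof.
move=> s_sorted s_ge0 le_ij.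
have nth_ge0 k : 0 <= s`_k.
  have [lt_ks|le_sk] := ltnP k (size s); last by rewrite nth_default.
  by rewrite s_ge0 ?mem_nth.
rewrite nth_ge0 /=; have [lt_js|le_sj] := ltnP j (size s); last first.
  by rewrite (nth_default _ le_sj).
apply: (sorted_leq_nth (leT := fun x y : R => y <= x)) => //.
- by move=> y x z /[swap]; exact: le_trans.
- by rewrite inE (leq_ltn_trans le_ij).
Qed.

(** Of two distinct indices the larger is at least 1, so its term is at most
    [s]_1[; the other is at most]s[_0]. *)
Lemma sum_two_sqr_le_top (R : numDomainType) (s : seq R) (i j : nat) :
  sorted (fun x y : R => y <= x) s -> {in s, forall x, 0 <= x} -> i != j ->
  s`_i ^+ 2 + s`_j ^+ 2 <= s`_0 ^+ 2 + s`_1 ^+ 2.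
Proof.
move=> s_sorted s_ge0.
wlog lt_ij : i j / (i < j)%N => [th ne_ij|_].
  have [lt_ij|lt_ji|eq_ij] := ltngtP i j; first exact: th.
  - by rewrite addrC th // eq_sym.
  - by rewrite eq_ij eqxx in ne_ij.
have /andP[i0 i_top] := nth_nonincreasing s_sorted s_ge0 (leq0n i).
have /andP[j0 j_top] :=
  nth_nonincreasing s_sorted s_ge0 (leq_ltn_trans (leq0n i) lt_ij).
by rewrite lerD // lerXn2r // ?nnegrE // (le_trans _ i_top, le_trans _ j_top).
Qed.

Lemma half_frob_norm_skew_diag (R : realType) (n : nat) (M : 'M[R]_n)
    (d : 'rV[R]_n) (c : R) :
  0 <= c -> (forall i j, i != j -> d 0 i ^+ 2 + d 0 j ^+ 2 <= c) ->
  2^-1 * frob_norm (M *m diag_mx d - diag_mx d *m M^T) ^+ 2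
    <= frob_norm M ^+ 2 * c.
Proof.
move=> c_ge0 d_le; rewrite ler_pdivrMl ?ltr0n // frob_norm_sqr.
(* Symmetrising the bound in [i] and [j] makes the comparison possible entry by entry. *)
have -> : 2 * (frob_norm M ^+ 2 * c) =
          \sum_i \sum_j (M i j ^+ 2 + M j i ^+ 2) * c.
  under eq_bigr => i _ do rewrite -mulr_suml big_split /=.
  rewrite -mulr_suml big_split /= -frob_norm_sqr exchange_big /= -frob_norm_sqr.
  by ring.
apply: ler_sum => i _; apply: ler_sum => j _.
rewrite mul_mx_diag mul_diag_mx !mxE.
have [<-|ne_ij] := eqVneq i j.
  by rewrite mulrC subrr expr0n /= mulr_ge0 // addr_ge0 // sqr_ge0.
apply: le_trans (ler_wpM2l _ (d_le _ _ ne_ij)); last first.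
  by rewrite addr_ge0 // sqr_ge0.
(* Lagrange's identity: with x = [M i j] and y = [M j i], this square is (x^2 + y^2) (d_i^2 + d_j^2)
   - (x d_j - y d_i)^2. *)
have := sqr_ge0 (M i j * d 0 i + M j i * d 0 j).
by lra.
Qed.

Lemma pid_mx_isometry (R : realType) (m p : nat) :
  (p <= m)%N -> (pid_mx p : 'M[R]_(m, p))^T *m pid_mx p = 1%:M :> 'M_p.
Proof.
move=> le_pm; rewrite tr_pid_mx mul_pid_mx minnn (minn_idPr le_pm).
exact: pid_mx_1.
Qed.

Definition padded_row (R : realType) (m : nat) (s : seq R) : 'rV[R]_m :=
  \row_i s`_i.

Lemma rect_diag_pid (R : realType) (m p : nat) (s : p.-tuple R) :
  rect_diag m s = diag_mx (padded_row m s) *m pid_mx p.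
Proof.
apply/matrixP => i j; rewrite mul_diag_mx !mxE.
case: eqP => [-> |_] /=; last by rewrite mulr0.
by rewrite ltn_ord mulr1.
Qed.

(** The product truncates the diagonal after [p] places, where the padded row is already 0. *)
Lemma rect_diag_pidT (R : realType) (m p : nat) (s : p.-tuple R) :
  (p <= m)%N ->
  rect_diag m s *m (pid_mx p : 'M_(m, p))^T = diag_mx (padded_row m s).
Proof.
move=> le_pm; rewrite rect_diag_pid tr_pid_mx -mulmxA mul_pid_mx.
rewrite !minnn; apply/matrixP => i j; rewrite mul_diag_mx !mxE.
have [<-|ne_ij] := eqVneq i j; last first.
  by rewrite (val_eqE i j) (negPf ne_ij) mulr0.
rewrite eqxx; have [lt_ip|le_pi] := ltnP i p; first by rewrite mulr1.
by rewrite mulr0 nth_default // size_tuple.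
Qed.

(** Only [B] is diagonalised and [A] is arbitrary, so the lemma applies with either given matrix in
    the role of [B]. *)
Lemma half_frob_norm_skew_svd (R : realType) (m p : nat) (A B : 'M[R]_(m, p))
    (U : 'M[R]_m) (S : 'M[R]_(m, p)) (V : 'M[R]_p) (s : p.-tuple R) :
  (p <= m)%N -> is_svd B U S V s ->
  2^-1 * frob_norm (A^T *m B - B^T *m A) ^+ 2
    <= frob_norm A ^+ 2 * (s`_0 ^+ 2 + s`_1 ^+ 2) /\
  2^-1 * frob_norm (A *m B^T - B *m A^T) ^+ 2
    <= frob_norm A ^+ 2 * (s`_0 ^+ 2 + s`_1 ^+ 2).
Proof.
move=> le_pm [[UtU UUt] [VtV VVt] [s_sorted s_ge0] S_def B_def].
(* [C] is [A] in the singular bases of [B]; [M] is [C] padded with zero columns to a square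
   matrix. *)
pose C := U^T *m A *m V; pose E : 'M[R]_(m, p) := pid_mx p; pose M := C *m E^T.
pose D := diag_mx (padded_row m s).
have EtE : E^T *m E = 1%:M by exact: pid_mx_isometry.
have A_def : A = U *m C *m V^T.
  by rewrite /C !mulmxA UUt mul1mx -mulmxA VVt mulmx1.
have normM : frob_norm A = frob_norm M.
  rewrite A_def frob_norm_isometry // /M -[C in RHS]mul1mx frob_norm_isometry //.
  by rewrite trmx1 mulmx1.
have top_ge0 : 0 <= s`_0 ^+ 2 + s`_1 ^+ 2 by rewrite addr_ge0 // sqr_ge0.
have d_le (i j : 'I_m) : i != j ->
    padded_row m s 0 i ^+ 2 + padded_row m s 0 j ^+ 2
      <= s`_0 ^+ 2 + s`_1 ^+ 2.
  by move=> ne_ij; rewrite !mxE sum_two_sqr_le_top.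
have SE : S *m E^T = D by rewrite S_def rect_diag_pidT.
have DE : S = D *m E by rewrite S_def rect_diag_pid.
have Dt : D^T = D by exact: tr_diag_mx.
split.
  have -> : A^T *m B - B^T *m A = V *m (C^T *m S - S^T *m C) *m V^T.
    rewrite A_def B_def !trmx_mul !trmxK !mulmxA mulmxBr mulmxBl !mulmxA.
    by rewrite -!(mulmxA _ U^T U) UtU !mulmx1.
  (* This commutator is only [p] by [p]; conjugation by [E] embeds it in size [m] without changing
     its norm. *)
  rewrite frob_norm_isometry // -(frob_norm_isometry _ EtE EtE).
  have -> : E *m (C^T *m S - S^T *m C) *m E^T = M^T *m D - D *m (M^T)^T.
    by rewrite -{2}Dt -SE /M !trmx_mul !trmxK mulmxBr mulmxBl !mulmxA.
  by rewrite normM -(frob_normT M); exact: half_frob_norm_skew_diag.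
have -> : A *m B^T - B *m A^T = U *m (C *m S^T - S *m C^T) *m U^T.
  rewrite A_def B_def !trmx_mul !trmxK !mulmxA mulmxBr mulmxBl !mulmxA.
  by rewrite -!(mulmxA _ V^T V) VtV !mulmx1.
rewrite frob_norm_isometry // normM.
have -> : C *m S^T - S *m C^T = M *m D - D *m M^T.
  by rewrite DE /M !trmx_mul !trmxK Dt !mulmxA.
exact: half_frob_norm_skew_diag.
Qed.

(** By orthogonal invariance the squared norm is the sum of all squared singular values. *)
Lemma top_two_le_frob_norm (R : realType) (m p : nat) (B : 'M[R]_(m, p))
    (U : 'M[R]_m) (S : 'M[R]_(m, p)) (V : 'M[R]_p) (s : p.-tuple R) :
  (p <= m)%N -> is_svd B U S V s ->
  s`_0 ^+ 2 + s`_1 ^+ 2 <= frob_norm B ^+ 2.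
Proof.
move=> le_pm [[UtU _] [VtV _] _ S_def ->]; rewrite frob_norm_isometry //.
have -> : frob_norm S ^+ 2 = \sum_(j < p) s`_j ^+ 2.
  rewrite frob_norm_sqr exchange_big /=; apply: eq_bigr => j _.
  (* Column [j] of [S] vanishes off row [j], which exists because [p <= m]. *)
  rewrite (bigD1 (widen_ord le_pm j)) //= S_def !mxE eqxx big1 ?addr0 // => i.
  by rewrite -val_eqE /= mxE => /negPf ->; rewrite expr0n.
(* For [p] below 2 the missing singular values are the default 0. *)
case: p s {le_pm S_def UtU VtV B U S V} => [|[|p]] s.
- by rewrite !nth_default ?size_tuple // expr0n /= addr0 big_ord0.
- by rewrite big_ord1 (nth_default _ (_ : (_ <= 1)%N)) ?size_tuple //
    expr0n addr0.
rewrite !big_ord_recl addrA lerDl sumr_ge0 // => i _; exact: sqr_ge0.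
Qed.

Theorem theorem3p5 (R : realType) (m p : nat) (hp : (1 <= p)%N)
    (hpm : (p <= m)%N) (B1 B2 : 'M[R]_(m, p))
    (U1 U2 : 'M[R]_m) (P Sigma : 'M[R]_(m, p)) (V1 V2 : 'M[R]_p)
    (rho sigma : p.-tuple R)
    (svd1 : is_svd B1 U1 P V1 rho) (svd2 : is_svd B2 U2 Sigma V2 sigma) :
  let bound :=
    Num.min (frob_norm B1 ^+ 2 * (sigma`_0 ^+ 2 + sigma`_1 ^+ 2))
            (frob_norm B2 ^+ 2 * (rho`_0 ^+ 2 + rho`_1 ^+ 2)) in
  [/\ \tr (B1^T *m B2 *m B2^T *m B1) - \tr (B1^T *m B2 *m B1^T *m B2)
        <= bound,
      \tr (B1 *m B2^T *m B2 *m B1^T) - \tr (B1^T *m B2 *m B1^T *m B2)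
        <= bound,
      2^-1 * frob_norm (B1^T *m B2 - B2^T *m B1) ^+ 2
        <= frob_norm B1 ^+ 2 * frob_norm B2 ^+ 2
    & 2^-1 * frob_norm (B1 *m B2^T - B2 *m B1^T) ^+ 2
        <= frob_norm B1 ^+ 2 * frob_norm B2 ^+ 2].
Proof.
move=> bound.
have [first2 second2] := half_frob_norm_skew_svd B1 hpm svd2.
have [first1 second1] := half_frob_norm_skew_svd B2 hpm svd1.
(* Exchanging [B1] and [B2] only flips the sign of each difference. *)
rewrite -opprB frob_normN in first1; rewrite -opprB frob_normN in second1.
have top2 := top_two_le_frob_norm hpm svd2.
have first_tr : \tr (B1^T *m B2 *m B2^T *m B1) - \tr (B1^T *m B2 *m B1^T *m B2)
    = 2^-1 * frob_norm (B1^T *m B2 - B2^T *m B1) ^+ 2.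
  have := half_frob_norm_skew (B1^T *m B2).
  by rewrite !trmx_mul !trmxK !mulmxA => ->.
have second_tr : \tr (B1 *m B2^T *m B2 *m B1^T) - \tr (B1^T *m B2 *m B1^T *m B2)
    = 2^-1 * frob_norm (B1 *m B2^T - B2 *m B1^T) ^+ 2.
  have := half_frob_norm_skew (B1 *m B2^T).
  rewrite !trmx_mul !trmxK !mulmxA => ->; congr (_ - _).
  (* Transposition and cyclicity identify the traces of the squares of [B1 *m B2^T] and
     [B1^T *m B2]. *)
  by rewrite -mxtrace_tr !trmx_mul !trmxK mxtrace_mulC !mulmxA.
split.
- by rewrite first_tr le_min first2 first1.
- by rewrite second_tr le_min second2 second1.
- by rewrite (le_trans first2) // ler_wpM2l // sqr_ge0.
- by rewrite (le_trans second2) // ler_wpM2l // sqr_ge0.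
Qed.
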